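(* Let $X$ be a real Banach space. Then, for every $g\in\mathrm{Lip}_0(X)$ there is a sequence $\{g_n\}$ in $\mathrm{SA}(X)$ which converges weakly to $g$ (in the weak topology of the Banach space $\mathrm{Lip}_0(X)$). Moreover, the sequence $\{g_n\}$ can be chosen in such a way that one also has that $\|g_n\|\to\|g\|$ and that $\{g_n\}$ converges uniformly on the whole of $X$ to $g$.
   Context: Banach spaces are real and $X\neq\{0\}$. $\mathrm{Lip}_0(X)$ is the Banach space of all Lipschitz functions $f:X\to\mathbb{R}$ with $f(0)=0$, with norm $\|f\|=\sup\left\{\frac{|f(x)-f(y)|}{\|x-y\|}: x,y\in X,\ x\neq y\right\}$. $\mathrm{SA}(X)$ is the set of all $f\in\mathrm{Lip}_0(X)$ that attain their norm in the strong sense, i.e. for which there are $x,y\in X$, $x\neq y$, with $\|f\|=\frac{|f(x)-f(y)|}{\|x-y\|}$. *)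

(* Defs.v *)
From HB Require Import structures.
From mathcomp Require Import all_boot all_order all_algebra.
From mathcomp Require Import all_classical all_reals all_analysis.
From mathcomp Require Import ring.

Set Implicit Arguments.
Unset Strict Implicit.
Unset Printing Implicit Defensive.

Import Order.TTheory GRing.Theory Num.Theory.
Import numFieldNormedType.Exports.

Local Open Scope classical_set_scope.
Local Open Scope ring_scope.

Section lipschitz_functions.
Variables (R : realType) (X : normedModType R).
Implicit Types f g : X -> R.

Lemma lipschitzP f :
  lipschitz f <-> exists k, forall x y, `|f x - f y| <= k * `|x - y|.
Proof.
split=> [[M [_ Mf]]|[k kf]].
  exists (M + 1) => x y; have /Mf : M < M + 1 by rewrite ltrDl.
  by move=> /(_ (x, y)); apply.
exists k; split; first exact: num_real.
move=> M kM [x y] _ /=; apply: (le_trans (kf x y)).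
by rewrite ler_wpM2r// ltW.
Qed.

Definition lip0 : {pred X -> R} := fun f => `[< lipschitz f /\ f 0 = 0 >].

Lemma lip0_submod_closed : submod_closed lip0.
Proof.
split=> [|a f g /asboolP[/lipschitzP[k kf] f0] /asboolP[/lipschitzP[l lg] g0]].
  apply/asboolP; split=> //; apply/lipschitzP; exists 0 => x y.
  by rewrite mul0r subrr normr0.
apply/asboolP; split; last by rewrite !fctE f0 g0 scaler0 addr0.
apply/lipschitzP; exists (`|a| * k + l) => x y.
rewrite !fctE opprD addrACA -scalerBr mulrDl (le_trans (ler_normD _ _))//.
by rewrite lerD ?lg// normrZ -mulrA ler_wpM2l.
Qed.

HB.instance Definition _ := GRing.isSubmodClosed.Build R (X -> R) lip0
  lip0_submod_closed.

End lipschitz_functions.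

Record Lip0 (R : realType) (X : normedModType R) :=
  MkLip0 { lip0_fun :> X -> R ; _ : lip0_fun \in @lip0 R X }.

Section Lip0_normed_module.
Variables (R : realType) (X : normedModType R).

HB.instance Definition _ := [isSub for @lip0_fun R X].
HB.instance Definition _ := [Choice of Lip0 X by <:].
HB.instance Definition _ := [SubChoice_isSubLmodule of Lip0 X by <:].

Implicit Types f g : Lip0 X.

Definition lip0_slopes f : set R :=
  [set r | exists x y : X, x != y /\ r = `|f x - f y| / `|x - y|].

(* On the trivial space there is no slope, and [sup set0 = 0]. *)
Definition lip0_norm f : R := sup (lip0_slopes f).

Lemma lip0_eq0 f : f 0 = 0.
Proof. by case: f => f /= /asboolP[]. Qed.

Lemma lip0_lipschitz f :
  exists k, forall x y, `|f x - f y| <= k * `|x - y|.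
Proof. by apply/lipschitzP; case: f => f /= /asboolP[]. Qed.

Lemma lip0_slopes_ubound f : has_ubound (lip0_slopes f).
Proof.
have [k kf] := lip0_lipschitz f; exists k => _ [x [y [xy ->]]].
by rewrite ler_pdivrMr ?normr_gt0 ?subr_eq0.
Qed.

Lemma lip0_norm_ge0 f : 0 <= lip0_norm f.
Proof.
rewrite /lip0_norm; have [->|/set0P[r fr]] := eqVneq (lip0_slopes f) set0.
  by rewrite sup0.
apply: (@le_trans _ _ r); last exact: (ub_le_sup (lip0_slopes_ubound f)).
by case: fr => x [y [_ ->]]; rewrite divr_ge0.
Qed.

Lemma lip0_norm_lipschitz f x y : `|f x - f y| <= lip0_norm f * `|x - y|.
Proof.
have [->|xy] := eqVneq x y; first by rewrite !subrr !normr0 mulr0.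
rewrite -ler_pdivrMr ?normr_gt0 ?subr_eq0//.
by apply: (ub_le_sup (lip0_slopes_ubound f)); exists x, y.
Qed.

Lemma lip0_norm_le f (k : R) : 0 <= k ->
  (forall x y, `|f x - f y| <= k * `|x - y|) -> lip0_norm f <= k.
Proof.
move=> k0 kf; rewrite /lip0_norm.
have [->|/set0P f0] := eqVneq (lip0_slopes f) set0; first by rewrite sup0.
apply: ge_sup => // _ [x [y [xy ->]]].
by rewrite ler_pdivrMr ?normr_gt0 ?subr_eq0.
Qed.

Lemma lip0_ler_normD f g : lip0_norm (f + g) <= lip0_norm f + lip0_norm g.
Proof.
apply: lip0_norm_le => [|x y]; first by rewrite addr_ge0 ?lip0_norm_ge0.
rewrite /= !fctE opprD addrACA mulrDl (le_trans (ler_normD _ _))//.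
by rewrite lerD// lip0_norm_lipschitz.
Qed.

Lemma lip0_norm_scale_le (a : R) f : lip0_norm (a *: f) <= `|a| * lip0_norm f.
Proof.
apply: lip0_norm_le => [|x y]; first by rewrite mulr_ge0 ?lip0_norm_ge0.
by rewrite /= !fctE -scalerBr normrZ -mulrA ler_wpM2l// lip0_norm_lipschitz.
Qed.

Lemma lip0_normrZ (a : R) f : lip0_norm (a *: f) = `|a| * lip0_norm f.
Proof.
apply/eqP; rewrite eq_le lip0_norm_scale_le/=.
have [->|a0] := eqVneq a 0; first by rewrite normr0 mul0r lip0_norm_ge0.
rewrite -ler_pdivlMl ?normr_gt0// -normfV.
by apply: le_trans (lip0_norm_scale_le _ _); rewrite scalerA mulVf// scale1r.
Qed.

Lemma lip0_norm0_eq0 f : lip0_norm f = 0 -> f = 0.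
Proof.
move=> f0; apply/val_inj/funext => x /=; apply/eqP; rewrite -normr_le0.
have := lip0_norm_lipschitz f x 0.
by rewrite f0 mul0r lip0_eq0 subr0.
Qed.

HB.instance Definition _ := @Lmodule_isNormed.Build R (Lip0 X) lip0_norm
  lip0_ler_normD lip0_normrZ lip0_norm0_eq0.

Lemma Lip0_normE f : `|f| =
  sup [set r | exists x y : X, x != y /\ r = `|f x - f y| / `|x - y|].
Proof. by []. Qed.

Lemma Lip0_complete (F : set_system (Lip0 X)) :
  ProperFilter F -> cauchy F -> cvg F.
Proof.
move=> FF /cauchy_ballP Fc.
have {}Fc e : 0 < e ->
    exists2 A, F A & forall f g, A f -> A g -> lip0_norm (f - g) <= e.
  move=> e0; have [[A B]/= [FA FB] AB] := Fc e e0.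
  exists (A `&` B); first exact: filterI.
  move=> f g [Af _] [_ Bg]; have /= := AB (f, g) (conj Af Bg).
  by rewrite -ball_normE/= => /ltW.
pose h x : R := lim ((f : Lip0 X) x @[f --> F]).
have Fh x : (f : Lip0 X) x @[f --> F] --> h x.
  apply: cauchy_cvg; apply/cauchy_ballP => e e0.
  have e1 : 0 < e / (`|x| + 1) by rewrite divr_gt0// ltr_wpDl.
  have [A FA Ae] := Fc _ e1.
  exists ((fun f : Lip0 X => f x) @` A, (fun f : Lip0 X => f x) @` A) => /=.
    by split; apply: (@filterS _ F _ A) => // f Af; exists f.
  move=> [_ _] [/= [f Af <-] [g Ag <-]]; rewrite -ball_normE/=.
  have := lip0_norm_lipschitz (f - g) x 0.
  rewrite lip0_eq0 !subr0 /= !fctE => /le_lt_trans; apply.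
  apply: (@le_lt_trans _ _ (e / (`|x| + 1) * `|x|)).
    by rewrite ler_wpM2r// Ae.
  by rewrite mulrAC ltr_pdivrMr ?ltr_wpDl// ltr_pM2l// ltrDl.
have FhB e : 0 < e -> exists2 A, F A & forall f, A f -> forall x y,
    `|(f x - h x) - (f y - h y)| <= e * `|x - y|.
  move=> e0; have [A FA Ae] := Fc _ e0; exists A => // f Af x y.
  apply/ler_addgt0Pr => d d0; have d2 : 0 < d / 2 by rewrite divr_gt0.
  near F => g.
  have Ag : A g by near: g.
  have -> : f x - h x - (f y - h y) =
      (f x - g x - (f y - g y)) + ((h y - g y) - (h x - g x)).
    by ring.
  rewrite (le_trans (ler_normD _ _))// lerD//.
    apply: (le_trans (lip0_norm_lipschitz (f - g) x y)).
    by rewrite ler_wpM2r// Ae.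
  rewrite (le_trans (ler_normB _ _))// (splitr d) lerD//.
    by near: g; exact: (@cvgr_dist_le _ _ _ F _ _ _ (Fh y)).
  by near: g; exact: (@cvgr_dist_le _ _ _ F _ _ _ (Fh x)).
have hP : h \in @lip0 R X.
  apply/asboolP; split.
    apply/lipschitzP; have [A FA Ae] := FhB 1 ltr01.
    have [f Af] := filter_ex FA; exists (lip0_norm f + 1) => x y.
    have -> : h x - h y = (f x - f y) - (f x - h x - (f y - h y)) by ring.
    rewrite mulrDl (le_trans (ler_normB _ _))// lerD ?Ae//.
    exact: lip0_norm_lipschitz.
  rewrite /h (_ : (fun f : Lip0 X => f 0) = fun=> 0); first exact: lim_cst.
  by apply/funext => f; exact: lip0_eq0.
apply/cvg_ex; exists (MkLip0 hP); apply/cvgrPdist_le => e e0.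
have [A FA Ae] := FhB e e0; apply: filterS FA => f Af.
rewrite distrC; apply: lip0_norm_le => [|x y]; first exact: ltW.
exact: Ae.
Unshelve. all: by end_near. Qed.

HB.instance Definition _ := Uniform_isComplete.Build (Lip0 X) Lip0_complete.

(* Strong norm attainment: the supremum defining the norm is a maximum. *)
Definition SA : set (Lip0 X) :=
  [set f : Lip0 X | exists x y : X, x != y /\ `|f| = `|f x - f y| / `|x - y|].

End Lip0_normed_module.

Arguments SA {R} X _.

Section weak_topology.
Variables (R : realType) (V : normedModType R).

Definition dual : Type := {phi : {linear V -> R} | continuous phi}.

(* The coarsest topology making every element of the dual continuous. *)
Definition weak : Type :=
  sup_topology (fun phi : dual =>
    Topological.on (initial_topology (sval phi : V -> R))).

HB.instance Definition _ := Topological.on weak.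

Lemma weak_cvgP (F : set_system V) (v : V) : Filter F ->
  F --> (v : weak) <->
  forall phi : {linear V -> R}, continuous phi -> phi @ F --> phi v.
Proof.
move=> FF; rewrite cvg_sup; split=> [Fv phi cphi|Fv [phi cphi]].
  have /= {}Fv := Fv (exist _ phi cphi).
  move=> A /= /(@initial_continuous _ _ (phi : V -> R) v) /Fv.
  exact.
move=> A; rewrite nbhsE => -[B [[C oC <-] Cv] CA].
apply: (filterS CA); apply: (Fv _ cphi).
exact: open_nbhs_nbhs.
Qed.

End weak_topology.

(* Main.v *)
(* Call a point p steep for g if, in some direction v, the slopes of g between
   p and p - s v are nearly ||g|| at every scale s <= 1.  By a Rolle argument
   steep points exist on every segment along which g has a large slope, and
   hence near every steep point; so there are steep points q_n, of slope
   tending to ||g||, with pairwise disjoint balls around them that avoid 0.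
   Inside the n-th ball g is changed, by gluing a small cone at q_n, into h_n
   which attains the norm ||g|| + 1/(n+1) at a pair of points of that ball.  The
   differences h_n - g are bounded with disjoint supports, so their
   signed finite sums are bounded and they tend weakly to 0. *)
Require Import Defs.
From mathcomp Require Import all_boot all_order all_algebra.
From mathcomp Require Import all_classical all_reals all_analysis.
From mathcomp Require Import ring lra.

Set Implicit Arguments.
Unset Strict Implicit.
Unset Printing Implicit Defensive.

Import Order.TTheory GRing.Theory Num.Theory.
Import numFieldNormedType.Exports.

Local Open Scope classical_set_scope.
Local Open Scope ring_scope.

(** * Gluing a cone onto a Lipschitz function *)

Lemma ler_dist_max (R : realDomainType) (a b c d k : R) :
  `|a - c| <= k -> `|b - d| <= k -> `|Num.max a b - Num.max c d| <= k.
Proof.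
rewrite !ler_norml => /andP[? ?] /andP[? ?].
by rewrite /Num.max; case: (ltP a b) => ?; case: (ltP c d) => ?; lra.
Qed.

(* A cone of slope [L + e] with apex over [p] is glued onto [f]; its height
   makes it pass through [(x, f x)]. *)
Lemma cone_modification (R : realType) (X : normedModType R) (f : X -> R)
    (L e : R) (p x : X) : 0 <= L -> 0 <= e ->
  (forall a b, `|f a - f b| <= L * `|a - b|) ->
  (L - e) * `|p - x| <= `|f p - f x| ->
  exists F : X -> R,
    [/\ forall a b, `|F a - F b| <= (L + e) * `|a - b|,
        `|F p - F x| = (L + e) * `|p - x|,
        F x = f x
      & forall u, 2 * `|p - x| <= `|p - u| -> F u = f u].
Proof.
move=> L0 e0; wlog fxp : f / f x <= f p => [wl|] fL fpx.
  have [|/ltW fpx'] := leP (f x) (f p); first by move=> fxy; exact: wl.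
  have [| a b | |F [FL Fpx Fx Fu]] := wl (fun u => - f u).
  - by rewrite lerN2.
  - by rewrite -opprD normrN.
  - by rewrite -opprD normrN.
  exists (fun u => - F u); split=> [a b| | |u /Fu].
  - by rewrite -opprD normrN.
  - by rewrite -opprD normrN.
  - by rewrite Fx opprK.
  - by move=> ->; rewrite opprK.
rewrite ger0_norm ?subr_ge0// in fpx.
have d0 : 0 <= `|p - x| by [].
have := fL p x; rewrite ger0_norm ?subr_ge0// => fpx'.
exists (fun u => Num.max (f u) (f x + (L + e) * (`|p - x| - `|p - u|))).
have Fx : Num.max (f x) (f x + (L + e) * (`|p - x| - `|p - x|)) = f x.
  by rewrite subrr mulr0 addr0 maxxx.
split=> [a b| | //|u hu].
- apply: ler_dist_max.
    by rewrite (le_trans (fL a b))// ler_wpM2r// lerDl.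
  have -> : f x + (L + e) * (`|p - x| - `|p - a|) -
      (f x + (L + e) * (`|p - x| - `|p - b|)) =
      (L + e) * (`|p - b| - `|p - a|) by ring.
  rewrite normrM ger0_norm ?addr_ge0// ler_wpM2l ?addr_ge0//.
  rewrite (le_trans (ler_dist_dist _ _))//.
  by rewrite opprB addrC addrA subrK.
- rewrite Fx subrr normr0 subr0 max_r; last by nra.
  by rewrite addrAC subrr add0r ger0_norm// mulr_ge0// addr_ge0.
(* With [d = |p - x|], [f u] is at least [f x + (L - e) d - L |p - u|], which exceeds the cone by
   [e (|p - u| - 2 d)]; hence the radius [2 d]. *)
- apply: max_l; have := fL p u; rewrite ler_norml => /andP[_ fpu].
  have : 0 <= e * (`|p - u| - 2 * `|p - x|) by rewrite mulr_ge0// subr_ge0.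
  by nra.
Qed.

(** * Steep points *)

(** Every scale [s <= 1] is required, so that pairs [p], [p - s v] of large slope exist inside any
    ball around [p]. *)
Definition steep (R : realType) (X : normedModType R) (f : X -> R) (c : R) :
    set X :=
  [set p | exists2 v, v != 0 &
    forall s, 0 < s <= 1 -> c * `|s *: v| <= `|f p - f (p - s *: v)|].

Lemma steep_le (R : realType) (X : normedModType R) (f : X -> R) (c d : R) :
  c <= d -> steep f d `<=` steep f c.
Proof.
move=> cd p [v v0 vd]; exists v => // s /vd; apply: le_trans.
by rewrite ler_wpM2r.
Qed.

Lemma lipschitz_line_continuous (R : realType) (X : normedModType R)
    (f : X -> R) (k : R) (x v : X) :
  (forall a b, `|f a - f b| <= k * `|a - b|) ->
  continuous (fun t : R => f (x + t *: v)).
Proof.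
move=> fk t; apply/cvgrPdist_le => e e0.
have K0 : 0 < `|k| * `|v| + 1 by rewrite ltr_wpDl// mulr_ge0.
near=> s.
apply: le_trans (fk _ _) _; rewrite opprD addrACA subrr add0r -scalerBl normrZ.
apply: (@le_trans _ _ ((`|k| * `|v| + 1) * `|t - s|)).
  rewrite mulrCA mulrC ler_wpM2r// (le_trans (_ : _ <= `|k| * `|v|)) ?lerDl//.
  by rewrite ler_wpM2r// ler_norm.
rewrite mulrC -ler_pdivlMr//; near: s.
by apply: cvgr_dist_le; [exact: cvg_id|rewrite divr_gt0].
Unshelve. all: by end_near. Qed.

(* As in Rolle's theorem: where [t |-> f (x + t (y - x)) - c t |y - x|] is
   maximal, all the backward slopes are at least [c]. *)
Lemma steep_segment (R : realType) (X : normedModType R) (f : X -> R)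
    (k c : R) (x y : X) :
  (forall a b, `|f a - f b| <= k * `|a - b|) ->
  x != y -> c * `|x - y| <= `|f x - f y| ->
  exists2 t : R, 0 <= t <= 1 & steep f c (x + t *: (y - x)).
Proof.
move=> fk; wlog fxy : x y / f x <= f y => [wl xy cxy|xy cxy].
  have [fxy|/ltW fyx] := leP (f x) (f y); first exact: wl.
  have [||t t01 st] := wl y x fyx; first by rewrite eq_sym.
    by rewrite distrC (distrC (f y)).
  exists (1 - t); first by lra.
  by rewrite scalerBl scale1r -scalerN opprB addrA subrKC.
rewrite distrC (distrC (f x)) ger0_norm ?subr_ge0// in cxy.
pose phi t := f (x + t *: (y - x)) - c * (t * `|y - x|).
have phic : continuous phi.
  move=> t; apply: cvgB; first exact: (@lipschitz_line_continuous _ _ _ k).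
  by apply: cvgM; [exact: cvg_cst|apply: cvgM; [exact: cvg_id|exact: cvg_cst]].
have [t t01 tmax] : exists2 t, 0 < t <= 1 &
    forall s, 0 <= s <= 1 -> phi s <= phi t.
  have [|t] := @EVT_max R phi 0 1 ler01; first exact: continuous_subspaceT.
  rewrite in_itv/= => /andP[t0 t1] tmax.
  move: t0; rewrite le_eqVlt => /predU1P[t0|t0]; last first.
    by exists t => [|s s01]; [rewrite t0|apply: tmax; rewrite in_itv].
  (* A maximum at 0 is one at 1 too, since the slope hypothesis gives [phi 0 <= phi 1]; a maximiser
     [t > 0] leaves room behind it. *)
  exists 1 => [|s s01]; first by rewrite ltr01 lexx.
  apply: (@le_trans _ _ (phi t)); first by apply: tmax; rewrite in_itv.
  rewrite -t0 /phi !scale0r !mul0r mulr0 subr0 addr0 scale1r mul1r.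
  by rewrite subrKC lerBrDr -lerBrDl.
have /andP[t0 t1] := t01.
exists t; first by rewrite ltW.
exists (t *: (y - x)); first by rewrite scaler_eq0 gt_eqF//= subr_eq0 eq_sym.
move=> s /andP[s0 s1].
have /tmax : 0 <= t - s * t <= 1 by nra.
rewrite /phi scalerA -[x + _ - _]addrA -scalerBl normrZ.
rewrite gtr0_norm ?mulr_gt0// => ?.
apply: le_trans (ler_norm _); lra.
Qed.

(** From [p] to [p - s v] the values of [f] differ by at least [(L - e) s |v|], of which the first
    half takes at most [L (s / 2) |v|]. The second half, which omits [p], thus has slope at least
    [L - 2 e] and contains a steep point. *)
Lemma steep_limit_point (R : realType) (X : normedModType R) (f : X -> R)
    (L e r : R) (p : X) :
  (forall a b, `|f a - f b| <= L * `|a - b|) ->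
  steep f (L - e) p -> 0 < r ->
  exists q, [/\ q != p, `|p - q| < r & steep f (L - 2 * e) q].
Proof.
move=> fL [v v0 pv] r0; have nv0 : 0 < `|v| by rewrite normr_gt0.
pose s := Num.min 1 (r / 2 / `|v|).
have s0 : 0 < s by rewrite lt_min ltr01 !divr_gt0.
have s1 : s <= 1 by rewrite ge_min lexx.
have sr : s * `|v| < r.
  apply: (@le_lt_trans _ _ (r / 2)); last by lra.
  by rewrite -ler_pdivlMr// ge_min lexx orbT.
have ab : (p - s *: v) - (p - (s / 2) *: v) = - (s / 2) *: v.
  rewrite opprB addrC addrA subrK -scalerBl; congr (_ *: _); lra.
have nab : `|(p - s *: v) - (p - (s / 2) *: v)| = s / 2 * `|v|.
  by rewrite ab normrZ normrN gtr0_norm// divr_gt0.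
have [||t t01] := @steep_segment _ _ f L (L - 2 * e) (p - s *: v)
    (p - (s / 2) *: v) fL.
- by rewrite -subr_eq0 -normr_eq0 nab mulf_neq0 ?gt_eqF// divr_gt0.
- have /pv : 0 < s <= 1 by rewrite s0.
  rewrite nab normrZ gtr0_norm// => h.
  have := fL p (p - (s / 2) *: v).
  rewrite subKr normrZ gtr0_norm ?divr_gt0// => h'.
  have := ler_distD (f (p - (s / 2) *: v)) (f p) (f (p - s *: v)).
  rewrite (distrC (f (p - s *: v))); lra.
rewrite -[_ - (p - s *: v)]opprB ab scaleNr opprK scalerA => sq.
have E : p - s *: v + (t * (s / 2)) *: v = p - (s - t * (s / 2)) *: v.
  by rewrite scalerBl opprB addrA addrAC.
exists (p - s *: v + (t * (s / 2)) *: v); split=> //; rewrite E.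
  rewrite eq_sym -subr_eq0 subKr scaler_eq0 negb_or v0 andbT.
  by rewrite gt_eqF//; nra.
rewrite subKr normrZ (le_lt_trans _ sr)// ler_wpM2r//.
by rewrite ger0_norm; nra.
Qed.

(** * Choice of disjoint balls around accumulating points *)

Section disjoint_balls.
Variables (R : realType) (X : normedModType R) (G : R -> set X).
Hypothesis G_le : forall d e, d <= e -> G d `<=` G e.
Hypothesis G_neq0 : forall e, 0 < e -> exists p, G e p.
Hypothesis G_acc : forall e p r, 0 < e -> 0 < r -> G e p ->
  exists q, [/\ q != p, `|p - q| < r & G (2 * e) q].

(** Invariant of the inductive choice. [G e] stands for the points where [g] is steep with constant
    [|g| - e], [e] being the defect. *)
Let rich (W : set X) := open W /\ forall e, 0 < e -> exists2 p, W p & G e p.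

Let open_dist (W : set X) p : open W -> W p ->
  exists2 r, 0 < r & forall x, `|p - x| < r -> W x.
Proof.
move=> oW Wp; have := open_nbhs_nbhs (conj oW Wp).
rewrite -nbhs_ballE => -[r r0 rW].
by exists r => // x px; apply: rW; rewrite -ball_normE.
Qed.

Let dist_continuous p : continuous (fun x : X => `|p - x|).
Proof.
by move=> x; apply: cvg_norm; apply: cvgB; [exact: cvg_cst|exact: cvg_id].
Qed.

Let open_dist_gt p d : open [set x : X | d < `|p - x|].
Proof.
by apply: (@open_comp _ _ (fun x => `|p - x|) [set y | d < y]);
  [move=> x _; exact: dist_continuous|exact: open_gt].
Qed.

Let rich_other W e p : rich W -> 0 < e -> W p -> G e p ->
  exists q, [/\ q != p, W q & G (2 * e) q].
Proof.
move=> [oW _] e0 Wp Gp; have [r r0 rW] := open_dist oW Wp.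
by have [q [qp /rW Wq Gq]] := G_acc e0 r0 Gp; exists q.
Qed.

(* For two points of [W] in [G e], either the richness of [W] persists near the
   first one, and a ball around the second is taken, or it persists off a
   neighbourhood of the first one. *)
Let rich_step W e : rich W -> 0 < e ->
  exists q r W', [/\ 0 < r, G e q, rich W' &
    [/\ forall x, `|q - x| < r -> W x, W' `<=` W &
        forall x, `|q - x| < r -> ~ W' x]].
Proof.
move=> rW e0; have [oW Wne] := rW.
have e2 : 0 < e / 2 by rewrite divr_gt0.
(* Accumulation doubles the defect, so [e / 2] puts both [p] and [q] in [G e]. *)
have [p Wp Gp] := Wne _ e2.
have [q [qp Wq]] := rich_other rW e2 Wp Gp.
rewrite mulrC divfK ?pnatr_eq0// => Gq.
pose d := `|p - q| / 2.
have d0 : 0 < d by rewrite divr_gt0// normr_gt0 subr_eq0 eq_sym.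
(* [U] and [V] cover [W], yet the ball of radius [d] at [q] misses [U] and that of radius [d / 2] at
   [p] misses [V]. *)
pose U := W `&` [set x | `|p - x| < d].
pose V := W `&` [set x | d / 2 < `|p - x|].
have oU : open U.
  apply: openI => //.
  by apply: (@open_comp _ _ (fun x => `|p - x|) [set y | y < d]);
    [move=> x _; exact: dist_continuous|exact: open_lt].
have oV : open V by apply: openI => //; exact: open_dist_gt.
have [rp rp0 rpW] := open_dist oW Wp.
have [rq rq0 rqW] := open_dist oW Wq.
have [rU|nU] := pselect (rich U).
  exists q, (Num.min d rq), U; split=> //; first by rewrite lt_min d0.
  split=> [x|x []|x] //; rewrite lt_min => /andP[xd xrq]; first exact: rqW.
  move=> [_ /= pxd]; have := ler_distD x p q; rewrite (distrC x).
  by rewrite /d in xd pxd; lra.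
have [rV|nV] := pselect (rich V).
  exists p, (Num.min (d / 2) rp), V; split=> //.
  - by rewrite lt_min rp0 divr_gt0.
  - by apply: G_le Gp; lra.
  split=> [x|x []|x] //; rewrite lt_min => /andP[xd xrp]; first exact: rpW.
  by move=> [_ /= pxd]; lra.
exfalso.
(* If neither part is rich, each excludes some defect, [a] or [b]; the smaller one then occurs
   nowhere in [W]. *)
have [a a0 aU] : exists2 a, 0 < a & forall x, U x -> ~ G a x.
  apply: contrapT => na; apply: nU; split=> // a a0; apply: contrapT => nUa.
  by apply: na; exists a => // x Ux Gx; apply: nUa; exists x.
have [b b0 bV] : exists2 b, 0 < b & forall x, V x -> ~ G b x.
  apply: contrapT => nb; apply: nV; split=> // b b0; apply: contrapT => nVb.
  by apply: nb; exists b => // x Vx Gx; apply: nVb; exists x.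
have [|x Wx Gx] := Wne (Num.min a b); first by rewrite lt_min a0.
have [xd|xd] := ltP `|p - x| d.
  by apply: (aU x) => //; apply: G_le Gx; rewrite ge_min lexx.
apply: (bV x); last by apply: G_le Gx; rewrite ge_min lexx orbT.
by split=> //=; lra.
Qed.

(** Iteration of [rich_step] from the complement of [a]: each ball lies in the current set and
    misses the next one; the sets decrease, so the balls are disjoint and omit [a]. *)
Lemma disjoint_balls (a : X) (e_ : nat -> R) : (forall n, 0 < e_ n) ->
  exists (q : nat -> X) (r : nat -> R),
    [/\ forall n, 0 < r n, forall n, G (e_ n) (q n),
        forall n, r n <= `|q n - a| &
        forall m n x, `|q m - x| < r m -> `|q n - x| < r n -> m = n].
Proof.
move=> e0.
have /choice[F FP] : forall nW : nat * {W | rich W},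
    exists z : X * R * {W | rich W},
    [/\ 0 < z.1.2, G (e_ nW.1) z.1.1 &
    [/\ forall x, `|z.1.1 - x| < z.1.2 -> sval nW.2 x,
        sval z.2 `<=` sval nW.2 &
        forall x, `|z.1.1 - x| < z.1.2 -> ~ sval z.2 x]].
  move=> [n [W rW]]; have [q [r [W' [r0 Gq rW' H]]]] := rich_step rW (e0 n).
  by exists (q, r, exist _ W' rW').
have rW0 : rich [set x | x != a].
  have oa : open [set x : X | x != a].
    rewrite (_ : [set x : X | x != a] = [set x | 0 < `|a - x|]).
      exact: open_dist_gt.
    by apply/seteqP; split=> x /=; rewrite normr_gt0 subr_eq0 eq_sym.
  split=> // e e1; have e2 : 0 < e / 2 by rewrite divr_gt0.
  have [p Gp] := G_neq0 e2.
  have [pa|pa] := eqVneq p a; last by exists p => //; apply: G_le Gp; lra.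
  (* If the point found is [a] itself, another one replaces it, at the cost of doubling the
     defect. *)
  have [q [qp _]] := G_acc e2 ltr01 Gp.
  by rewrite mulrC divfK ?pnatr_eq0// => Gq; exists q; rewrite //= -pa.
pose W_ := fix W_ n : {W | rich W} :=
  if n is m.+1 then (F (m, W_ m)).2 else exist _ _ rW0.
pose q n := (F (n, W_ n)).1.1; pose r n := (F (n, W_ n)).1.2.
have Wle m n : (m <= n)%N -> sval (W_ n) `<=` sval (W_ m).
  elim: n => [|n IH]; first by rewrite leqn0 => /eqP ->.
  rewrite leq_eqVlt => /predU1P[->//|]; rewrite ltnS => /IH mn.
  by apply: subset_trans mn; have [_ _ []] := FP (n, W_ n).
have qW n x : `|q n - x| < r n -> sval (W_ n) x.
  by have [_ _ [H _ _]] := FP (n, W_ n); exact: H.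
have qW' n x : `|q n - x| < r n -> ~ sval (W_ n.+1) x.
  by have [_ _ [_ _ H]] := FP (n, W_ n); exact: H.
exists q, r; split=> [n|n|n|m n x mx nx].
- by have [] := FP (n, W_ n).
- by have [] := FP (n, W_ n).
- rewrite leNgt; apply/negP => /qW /(Wle 0%N n (leq0n n)) /=.
  by rewrite eqxx.
- have [mn|nm|//] := ltngtP m n.
    by exfalso; apply: (qW' _ _ mx); apply: (Wle _ _ mn); exact: qW.
  by exfalso; apply: (qW' _ _ nx); apply: (Wle _ _ nm); exact: qW.
Qed.

End disjoint_balls.

(** * Norm-attaining modification inside a ball *)

(** The cone is glued at [p] and [p - s v] with [2 s |v| <= r], so the change stays in the ball of
    radius [r]; [r <= |p|] preserves the value at 0. *)
Lemma SA_modification (R : realType) (X : normedModType R) (g : Lip0 X)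
    (e r : R) (p : X) :
  0 < e -> 0 < r -> r <= `|p| -> steep g (`|g| - e) p ->
  exists h : Lip0 X,
    [/\ SA X h, `|h| = `|g| + e,
        forall u, r <= `|p - u| -> h u = g u &
        forall u, `|h u - g u| <= (2 * `|g| + e) * (2 * r)].
Proof.
move=> e0 r0 rp [v v0 pv]; have nv0 : 0 < `|v| by rewrite normr_gt0.
have gL a b : `|g a - g b| <= `|g| * `|a - b| by exact: lip0_norm_lipschitz.
pose s := Num.min 1 (r / 2 / `|v|).
have s0 : 0 < s by rewrite lt_min ltr01 !divr_gt0.
have sv : 2 * `|s *: v| <= r.
  rewrite normrZ gtr0_norm// mulrC -ler_pdivlMr// -ler_pdivlMr//.
  by rewrite ge_min lexx orbT.
have /pv : 0 < s <= 1 by rewrite s0 ge_min lexx.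
pose x := p - s *: v.
have px : p - x = s *: v by rewrite subKr.
rewrite -/x -px in sv * => gpx.
have npx : 0 < `|p - x| by rewrite px normr_gt0 scaler_eq0 gt_eqF.
have [F [FL Fpx Fx Fu]] := cone_modification (normr_ge0 g) (ltW e0) gL gpx.
have gF u : r <= `|p - u| -> F u = g u by move=> ru; apply/Fu/(le_trans sv).
have F0 : F 0 = 0 by rewrite gF ?subr0// lip0_eq0.
have FP : F \in @lip0 R X.
  by apply/asboolP; split=> //; apply/lipschitzP; exists (`|g| + e).
have nF : `|MkLip0 FP| = `|g| + e.
  apply/eqP; rewrite eq_le; apply/andP; split.
    by apply: lip0_norm_le; rewrite ?addr_ge0// ltW.
  have := lip0_norm_lipschitz (MkLip0 FP) p x.
  by rewrite /= Fpx ler_pM2r.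
exists (MkLip0 FP); split=> //=.
  exists p, x; split; first by rewrite -subr_eq0 -normr_gt0.
  by rewrite nF/= Fpx mulfK// gt_eqF.
have K0 : 0 <= 2 * `|g| + e by rewrite addr_ge0 ?mulr_ge0// ltW.
move=> u; have [ru|ru] := leP r `|p - u|.
  by rewrite gF// subrr normr0 mulr_ge0// mulr_ge0// ltW.
have ux : `|u - x| <= 2 * r.
  by have := ler_distD p u x; rewrite (distrC u p); lra.
(* [F] and [g] agree at [x], which is within [2 r] of [u], so the sum of their Lipschitz constants
   bounds the difference. *)
apply: (@le_trans _ _ ((2 * `|g| + e) * `|u - x|)); last first.
  by rewrite ler_wpM2l.
have -> : F u - g u = (F u - F x) - (g u - g x) by rewrite Fx; ring.
have -> : (2 * `|g| + e) * `|u - x| = (`|g| + e) * `|u - x| + `|g| * `|u - x|.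
  by ring.
by rewrite (le_trans (ler_normB _ _))// lerD.
Qed.

(** * Disjoint supports and weak convergence *)

(** Given [x] and [y], at most two of the [h i] are nonzero at one of them, and each contributes at
    most [C |x - y|]; whence a bound free of [n]. *)
Lemma lip0_norm_sum_disjoint (R : realType) (X : normedModType R)
    (h : nat -> Lip0 X) (C : R) (a : nat -> R) (n : nat) :
  (forall i, `|h i| <= C) -> (forall i, `|a i| <= 1) ->
  (forall i j x, h i x != 0 -> h j x != 0 -> i = j) ->
  `|\sum_(i < n) a i *: h i| <= 2 * C.
Proof.
move=> hC a1 hdisj; have C0 : 0 <= C := le_trans (normr_ge0 _) (hC 0%N).
apply: lip0_norm_le => [|x y]; first by rewrite mulr_ge0.
have sumE z : (\sum_(i < n) a i *: h i) z = \sum_(i < n) a i * h i z.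
  by rewrite (big_morph (fun f : Lip0 X => f z) (id1 := 0) (op1 := +%R)).
have supp z : exists j, forall i, i != j -> h i z = 0.
  have [[j hj]|nj] := pselect (exists j, h j z != 0).
    exists j => i ij; apply/eqP; apply: contraNT ij => hi.
    by rewrite (hdisj _ _ _ hi hj).
  by exists 0%N => i _; apply/eqP; apply: contraPT nj => hi; apply; exists i.
have [jx hx] := supp x; have [jy hy] := supp y.
(* Only an inequality, since the index [j] may lie outside the range of the sum. *)
have cnt j : \sum_(i < n) (if i == j :> nat then C * `|x - y| else 0)
    <= C * `|x - y|.
  rewrite -big_mkcond/=; have [jn|nj] := ltnP j n.
    by rewrite (big_pred1 (Ordinal jn)).
  rewrite big_pred0 ?mulr_ge0// => i.
  by apply/negbTE; rewrite neq_ltn (leq_trans (ltn_ord i) nj).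
rewrite !sumE -sumrB (le_trans (ler_norm_sum _ _ _))//.
have -> : 2 * C * `|x - y| = C * `|x - y| + C * `|x - y| by ring.
apply: le_trans (lerD (cnt jx) (cnt jy)); rewrite -big_split/=.
apply: ler_sum => i _; rewrite -mulrBr normrM.
have hi : `|a i| * `|h i x - h i y| <= C * `|x - y|.
  rewrite -[leRHS]mul1r ler_pM// (le_trans (lip0_norm_lipschitz _ _ _))//.
  by rewrite ler_wpM2r//; exact: hC.
have Cd : 0 <= C * `|x - y| by rewrite mulr_ge0.
case: eqP => [_|/eqP ix]; case: eqP => [_|/eqP iy]; rewrite ?addr0 ?add0r//.
  by rewrite (le_trans hi)// lerDl.
by rewrite hx// hy// subrr normr0 mulr0.
Qed.

(* The partial sums of [|phi (h i)|] are values of [phi] at signed sums of the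
   [h i], hence bounded. *)
Lemma disjoint_support_weakly_null (R : realType) (X : normedModType R)
    (h : nat -> Lip0 X) (C : R) (phi : {linear Lip0 X -> R}) :
  (forall i, `|h i| <= C) ->
  (forall i j x, h i x != 0 -> h j x != 0 -> i = j) ->
  continuous phi -> phi (h n) @[n --> \oo] --> 0.
Proof.
move=> hC hdisj cphi.
have [M phiM] : exists M, forall f, `|phi f| <= M * `|f|.
  have /linear_boundedP : bounded_near phi (nbhs (0 : Lip0 X)).
    by apply: continuous_linear_bounded; exact: cphi.
  by move=> /filter_ex[M HM]; exists M.
(* Terms of a convergent series tend to 0, so summability of [|phi (h i)|] is enough. *)
apply/norm_cvg0P; apply: (@cvg_series_cvg_0 _ R).
apply: nondecreasing_is_cvgn.
  by apply/nondecreasing_seqP => n; rewrite seriesSr lerDl.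
exists (`|M| * (2 * C)) => _ [n _ <-].
have -> : series (fun i => `|phi (h i)|) n =
    phi (\sum_(i < n) Num.sg (phi (h i)) *: h i).
  rewrite linear_sum /series/= big_mkord; apply: eq_bigr => i _.
  by rewrite linearZ/= normrEsg.
apply: le_trans (ler_norm _) _; apply: le_trans (phiM _) _.
apply: le_trans (_ : `|M| * `|\sum_(i < n) Num.sg (phi (h i)) *: h i| <= _).
  by rewrite ler_wpM2r// ler_norm.
rewrite ler_wpM2l//.
rewrite (lip0_norm_sum_disjoint (a := fun i => Num.sg (phi (h i))))//.
by move=> i; rewrite normr_sg lern1 leq_b1.
Qed.

(** The norm is a supremum of slopes, and a pair of slope above [|g| - e] yields a steep point on
    its segment. *)
Lemma steep_neq0 (R : realType) (X : normedModType R) (g : Lip0 X) (e : R) :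
  (exists x : X, x != 0) -> 0 < e -> exists p, steep g (`|g| - e) p.
Proof.
move=> [z z0] e0.
have [_ [x [y [xy ->]]] gxy] : exists2 s, lip0_slopes g s & `|g| - e < s.
  apply: sup_adherent => //; split; last exact: lip0_slopes_ubound.
  by exists (`|g z - g 0| / `|z - 0|), z, 0.
have gL a b : `|g a - g b| <= `|g| * `|a - b| by exact: lip0_norm_lipschitz.
have [|t _ st] := @steep_segment _ _ g `|g| (`|g| - e) x y gL xy.
  by rewrite -ler_pdivlMr ?normr_gt0 ?subr_eq0// ltW.
by exists (x + t *: (y - x)).
Qed.

(** * Assembly of the sequence *)

Theorem corollary2p8 (R : realType) (X : completeNormedModType R)
    (X_neq0 : exists x : X, x != 0) (g : Lip0 X) :
  exists g_ : nat -> Lip0 X,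
    [/\ forall n, SA X (g_ n),
        g_ n @[n --> \oo] --> (g : weak (Lip0 X)),
        `|g_ n| @[n --> \oo] --> `|g|
      & {uniform, (fun n => g_ n : X -> R) @ \oo --> (g : X -> R)}].
Proof.
have e0 n : 0 < (n.+1%:R)^-1 :> R by rewrite invr_gt0.
have [||e p r e1 r0 st|q [r [r0 Gq rq rdisj]]] :=
    @disjoint_balls R X (fun e => steep g (`|g| - e)) _ _ _ 0
      (fun n => n.+1%:R^-1) e0.
- by move=> d e de; apply: steep_le; rewrite lerB.
- by move=> e; exact: steep_neq0.
- apply: steep_limit_point => //; exact: lip0_norm_lipschitz.
(* Radii at most [1 / (n + 1)] give uniform convergence, the bound on [|h n u - g u|] being
   proportional to the radius; shrinking keeps the balls disjoint. *)
have rho0 n : 0 < Num.min (r n) n.+1%:R^-1 by rewrite lt_min r0 e0.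
have rhoq n : Num.min (r n) n.+1%:R^-1 <= `|q n|.
  by rewrite ge_min; have := rq n; rewrite subr0 => ->.
have /choice[h hP] n := SA_modification (e0 n) (rho0 n) (rhoq n) (Gq n).
have e1 n : n.+1%:R^-1 <= 1 :> R by rewrite invf_le1// ler1n.
have hg n u : h n u != g u -> `|q n - u| < r n.
  have [_ _ hu _] := hP n; rewrite ltNge; apply: contraNN => ru.
  by rewrite hu// ge_min ru.
exists h; split=> [n| | |].
- by have [] := hP n.
- apply/weak_cvgP => phi cphi.
  have : phi (h n - g) @[n --> \oo] --> 0.
    apply: (@disjoint_support_weakly_null _ _ _ (2 * `|g| + 1)) => // [n|i j x].
      have [_ hn _ _] := hP n.
      by rewrite (le_trans (ler_normB _ _))// hn mulr_natl mulr2n addrAC lerD2l.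
    by rewrite /= !fctE !subr_eq0 => /hg hi /hg; exact: rdisj.
  move=> /(cvgD (cvg_cst (phi g))); rewrite addr0.
  rewrite [X in X @ _ --> _](_ : _ = phi \o h)//.
  by apply/funext => n; rewrite /= !fctE linearB/= subrKC.
- have -> : (fun n => `|h n|) = (fun n => `|g| + harmonic n).
    by apply/funext => n; have [] := hP n.
  rewrite -[X in _ --> X]addr0.
  by apply: cvgD; [exact: cvg_cst|exact: cvg_harmonic].
- move=> P /uniform_nbhs[E [entE EP]].
  have [d /= d0 dE] : exists2 d : R, 0 < d &
      forall a b : R, `|a - b| < d -> E (a, b).
    move: entE; rewrite -entourage_ballE => -[d d0 dE].
    by exists d => // a b ab; apply: dE; rewrite /= -ball_normE.
  have K0 : 0 < (2 * `|g| + 1) * 2 by rewrite mulr_gt0// ltr_wpDl ?mulr_ge0.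
  near=> n; apply: EP => u _ /=; apply: dE; rewrite distrC.
  have [_ _ _ hu] := hP n; apply: le_lt_trans (hu u) _.
  apply: (@le_lt_trans _ _ ((2 * `|g| + 1) * 2 * harmonic n)).
    rewrite -mulrA ler_pM//.
    + by rewrite mulr_ge0// ltW.
    + by rewrite lerD2l.
    + by rewrite ler_pM2l// ge_min lexx orbT.
  rewrite mulrC -ltr_pdivlMr//.
  by near: n; apply: cvgr_lt; [exact: cvg_harmonic|rewrite divr_gt0].
Unshelve. all: by end_near. Qed.
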